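(* $(\mathfrak h_3\oplus\mathbb R,S_0^3,J)$ is a first kind algebraic Ricci soliton with respect to $\nabla^0$ with $c=-\frac34$: the linear map $D$ represented in the basis $\{v_1,v_2,v_3,v_4\}$ by $$\begin{bmatrix}\frac12&0&0&0\\0&1&0&0\\0&0&\frac12&-\frac14\\0&0&0&\frac34\end{bmatrix}$$ is a derivation of $\mathfrak h_3\oplus\mathbb R$, and $\operatorname{Ric}^0=-\frac34\operatorname{Id}+D$.
   Context: $\mathfrak h_3\oplus\mathbb R$ is the real Lie algebra with basis $e_1,e_2,e_3,e_4$ and only non-zero bracket (up to skew-symmetry) $[e_1,e_2]=e_3$. $S_0^3$ is the Lorentzian inner product $\langle\cdot,\cdot\rangle$ whose matrix in $(e_1,e_2,e_3,e_4)$ is $\begin{bmatrix}1&0&0&0\\0&0&0&1\\0&0&1&0\\0&1&0&0\end{bmatrix}$. Fix the basis $v_1=e_1$, $v_2=e_3$, $v_3=\frac1{\sqrt2}(e_2+e_4)$, $v_4=\frac1{\sqrt2}(e_2-e_4)$, which is orthonormal: $\langle v_i,v_j\rangle=0$ for $i\ne j$, $\langle v_i,v_i\rangle=1$ for $i=1,2,3$, $\langle v_4,v_4\rangle=-1$. The product structure $J$ is the linear map with $Jv_i=v_i$ for $i=1,2,3$ and $Jv_4=-v_4$. Write $\mathfrak g$ for the Lie algebra. The Levi-Civita connection is the bilinear map $\nabla:\mathfrak g\times\mathfrak g\to\mathfrak g$ with $2\langle\nabla_uv,w\rangle=\langle[u,v],w\rangle+\langle[w,u],v\rangle+\langle[w,v],u\rangle$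 for all $u,v,w$. Put $(\nabla_uJ)v=\nabla_u(Jv)-J(\nabla_uv)$. The canonical connection is $\nabla^0_uv=\nabla_uv-\frac12(\nabla_uJ)Jv$. Its curvature is $R^0_{uv}w=\nabla^0_{[u,v]}w-\nabla^0_u\nabla^0_vw+\nabla^0_v\nabla^0_uw$, and its Ricci operator is $\operatorname{Ric}^0(u)=\sum_{k=1}^4\langle v_k,v_k\rangle R^0_{v_ku}v_k$. A derivation of $\mathfrak g$ is a linear map $D:\mathfrak g\to\mathfrak g$ with $[D(u),v]+[u,D(v)]=D[u,v]$ for all $u,v\in\mathfrak g$. First kind algebraic Ricci soliton with respect to $\nabla^0$ means $\operatorname{Ric}^0=c\operatorname{Id}+D$ for some $c\in\mathbb R$ and some derivation $D$. In matrices, the $j$-th column contains the coordinates of the image of $v_j$ in the basis $(v_1,v_2,v_3,v_4)$. *)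

(* Defs.v *)
From HB Require Import structures.
From mathcomp Require Import all_boot all_order all_algebra.
From mathcomp Require Import sesquilinear reals.
From mathcomp Require Import ring lra.

Set Implicit Arguments.
Unset Strict Implicit.
Unset Printing Implicit Defensive.
Import Order.TTheory GRing.Theory Num.Theory.
Local Open Scope ring_scope.

Section Generic.
Variables (R : realType) (V : lmodType R).
Implicit Types (br nabla : V -> V -> V) (ip : V -> V -> R) (J : V -> V).

Definition is_lie_bracket br :=
  [/\ bilinear_for *:%R *:%R br,
      forall u, br u u = 0 &
      forall u v w, br u (br v w) + br v (br w u) + br w (br u v) = 0].

(* Koszul formula for left-invariant fields; together with bilinearity of
   [nabla] it characterises the Levi-Civita connection when [ip] is
   nondegenerate. *)
Definition koszul_formula br ip nabla :=
  forall u v w,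
    2 * ip (nabla u v) w = ip (br u v) w + ip (br w u) v + ip (br w v) u.

(* (nabla_u J) v *)
Definition nablaJ nabla J u v := nabla u (J v) - J (nabla u v).

Definition canonical_connection nabla J u v :=
  nabla u v - 2^-1 *: nablaJ nabla J u (J v).

Definition curvature br nabla u v w :=
  nabla (br u v) w - nabla u (nabla v w) + nabla v (nabla u w).

(* [vs] is meant to be an orthonormal basis for [ip]: the formula for the trace
   is only correct in that case. *)
Definition ricci_operator br ip nabla n (vs : n.-tuple V) u :=
  \sum_(k < n) ip vs`_k vs`_k *: curvature br nabla vs`_k u vs`_k.

Definition is_derivation br (D : {linear V -> V}) :=
  forall u v, br (D u) v + br u (D v) = D (br u v).

Definition first_kind_soliton br (Ric : V -> V) :=
  exists (c : R) (D : {linear V -> V}),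
    is_derivation br D /\ forall u, Ric u = c *: u + D u.

End Generic.

Section MatrixInBasis.
Variables (R : realType) (V : vectType R) (n : nat).
Variables (vs : n.-tuple V) (A : 'M[R]_n).

(* The endomorphism with matrix [A] in the basis [vs]: column j of [A] holds
   the coordinates of the image of vs`_j, see [map_of_mxE]. *)
Definition map_of_mx (u : V) : V :=
  \sum_(j < n) coord vs j u *: \sum_(i < n) A i j *: vs`_i.

Fact map_of_mx_is_linear : linear map_of_mx.
Proof.
move=> a u v; rewrite /map_of_mx scaler_sumr -big_split /=.
by apply: eq_bigr => j _; rewrite linearP /= scalerDl scalerA.
Qed.
HB.instance Definition _ :=
  GRing.isLinear.Build R V V *:%R map_of_mx map_of_mx_is_linear.

Lemma map_of_mxE (j : 'I_n) : free vs ->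
  map_of_mx vs`_j = \sum_(i < n) A i j *: vs`_i.
Proof.
move=> fr; rewrite /map_of_mx (bigD1 j) //= coord_free // eqxx scale1r.
rewrite [X in _ + X]big1 ?addr0 // => k kj.
by rewrite coord_free // eq_sym (negPf kj) scale0r.
Qed.

End MatrixInBasis.

Section H3R.
Variable R : realType.
Local Notation g := 'cV[R]_4.

Definition mx4 (rows : seq (seq R)) : 'M[R]_4 :=
  \matrix_(i, j) (nth [::] rows i)`_j.

Definition e1 : g := delta_mx 0 0.
Definition e2 : g := delta_mx 1 0.
Definition e3 : g := delta_mx 2 0.
Definition e4 : g := delta_mx 3 0.

(* Bracket of h_3 + R: the bilinear alternating extension of [e1, e2] = e3,
   all other brackets of basis vectors being zero, see [h3R_bracketE]. *)
Definition h3R_bracket (u v : g) : g :=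
  (u 0 0 * v 1 0 - u 1 0 * v 0 0) *: e3.

Definition S03_mx : 'M[R]_4 := mx4
  [:: [:: 1; 0; 0; 0];
      [:: 0; 0; 0; 1];
      [:: 0; 0; 1; 0];
      [:: 0; 1; 0; 0]].

Definition S03 (u v : g) : R := (u^T *m S03_mx *m v) 0 0.

Definition v1 : g := e1.
Definition v2 : g := e3.
Definition v3 : g := (Num.sqrt 2)^-1 *: (e2 + e4).
Definition v4 : g := (Num.sqrt 2)^-1 *: (e2 - e4).
Definition v_basis : 4.-tuple g := [tuple v1; v2; v3; v4].

Definition prodJ_mx : 'M[R]_4 := mx4
  [:: [:: 1; 0; 0;  0];
      [:: 0; 1; 0;  0];
      [:: 0; 0; 1;  0];
      [:: 0; 0; 0; -1]].

Definition prodJ : {linear g -> g} := map_of_mx v_basis prodJ_mx.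

Definition solitonD_mx : 'M[R]_4 := mx4
  [:: [:: 1 / 2; 0;     0;       0];
      [::     0; 1;     0;       0];
      [::     0; 0; 1 / 2; - (1 / 4)];
      [::     0; 0;     0;   3 / 4]].

Definition solitonD : {linear g -> g} := map_of_mx v_basis solitonD_mx.

Lemma colE (u v : g) :
  [/\ u 0 0 = v 0 0, u 1 0 = v 1 0, u 2 0 = v 2 0 & u 3 0 = v 3 0] -> u = v.
Proof.
case=> h0 h1 h2 h3; apply/matrixP => i j; rewrite ord1 {j}.
case: i => -[|[|[|[|//]]]] p.
- by rewrite (_ : Ordinal p = 0) //; apply/val_inj.
- by rewrite (_ : Ordinal p = 1) //; apply/val_inj.
- by rewrite (_ : Ordinal p = 2) //; apply/val_inj.
- by rewrite (_ : Ordinal p = 3) //; apply/val_inj.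
Qed.

Lemma S03E (u v : g) :
  S03 u v = u 0 0 * v 0 0 + u 1 0 * v 3 0 + u 2 0 * v 2 0 + u 3 0 * v 1 0.
Proof.
rewrite /S03 !mxE !big_ord_recr big_ord0 /= !mxE !big_ord_recr !big_ord0 /=.
rewrite !mxE /= !(mulr0, mulr1, add0r, addr0).
set i0 := widen_ord _ _; set i1 := widen_ord _ _.
set i2 := widen_ord _ _; set i3 := ord_max.
have -> : i0 = 0 by apply/val_inj.
have -> : i1 = 1 by apply/val_inj.
have -> : i2 = 2 by apply/val_inj.
have -> : i3 = 3 by apply/val_inj.
ring.
Qed.

Lemma S03_sym (u v : g) : S03 u v = S03 v u.
Proof. by rewrite !S03E; ring. Qed.

Lemma h3R_bracketE :
  [/\ h3R_bracket e1 e2 = e3, h3R_bracket e1 e3 = 0, h3R_bracket e1 e4 = 0,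
      h3R_bracket e2 e3 = 0 & h3R_bracket e2 e4 = 0] /\
  h3R_bracket e3 e4 = 0.
Proof.
by rewrite /h3R_bracket !mxE /= !(mulr0, mul0r, mulr1, subrr, subr0) !scale0r
  scale1r.
Qed.

Lemma h3R_lie : is_lie_bracket h3R_bracket.
Proof.
split.
- by split=> w a u v; apply: colE; rewrite /h3R_bracket /= !mxE /=; split; ring.
- by move=> u; rewrite /h3R_bracket mulrC subrr scale0r.
- by move=> u v w; apply: colE; rewrite /h3R_bracket !mxE /=; split; ring.
Qed.

Lemma v_basis_orthonormal (i j : 'I_4) :
  S03 v_basis`_i v_basis`_j = (i == j)%:R * (-1) ^+ (i == 3).
Proof.
have h : (Num.sqrt 2 : R)^-1 * (Num.sqrt 2)^-1 = 2^-1.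
  by rewrite -invfM -expr2 sqr_sqrtr // ler0n.
case: i => -[|[|[|[|//]]]] p; case: j => -[|[|[|[|//]]]] q;
  rewrite S03E /= !mxE -!val_eqE /= ?expr0 ?expr1 ?(mulr0, mul0r, mulr1, mul1r,
    addr0, add0r, subr0, sub0r, mulrN, mulNr) ?h;
  by field.
Qed.

Lemma v_basis_free : free v_basis.
Proof.
apply/freeP => k hk i.
have : S03 (\sum_(j < 4) k j *: v_basis`_j) v_basis`_i = 0.
  by rewrite hk S03E !mxE !mul0r !addr0.
rewrite /S03 linear_sum /= mulmx_suml mulmx_suml summxE (bigD1 i) //= big1; last first.
  move=> j ji; rewrite linearZ /= -!scalemxAl mxE.
  by rewrite -/(S03 _ _) v_basis_orthonormal (negPf ji) mul0r mulr0.
rewrite addr0 linearZ /= -!scalemxAl mxE -/(S03 _ _) v_basis_orthonormal eqxx.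
by rewrite mul1r => /eqP; rewrite mulf_eq0 signr_eq0 orbF => /eqP.
Qed.

Lemma v_basisP : basis_of fullv v_basis.
Proof.
by rewrite basisEfree v_basis_free subvf size_tuple dimvf.
Qed.

Lemma S03_bracket (u v w : g) :
  S03 (h3R_bracket u v) w = (u 0 0 * v 1 0 - u 1 0 * v 0 0) * w 2 0.
Proof.
by rewrite /S03 /h3R_bracket linearZ /= -!scalemxAl mxE -/(S03 _ _) S03E !mxE
  /= !(mul0r, mul1r, add0r, addr0).
Qed.

(* The connection in closed form, showing that [koszul_formula] has a (unique)
   solution here. *)
Definition levi_civita (u v : g) : g :=
  2^-1 *: ((u 1 0 * v 2 0 + u 2 0 * v 1 0) *: e1
           + (u 0 0 * v 1 0 - u 1 0 * v 0 0) *: e3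
           - (u 0 0 * v 2 0 + u 2 0 * v 0 0) *: e4).

Lemma levi_civitaE (u v : g) :
  [/\ levi_civita u v 0 0 = 2^-1 * (u 1 0 * v 2 0 + u 2 0 * v 1 0),
      levi_civita u v 1 0 = 0,
      levi_civita u v 2 0 = 2^-1 * (u 0 0 * v 1 0 - u 1 0 * v 0 0) &
      levi_civita u v 3 0 = - (2^-1 * (u 0 0 * v 2 0 + u 2 0 * v 0 0))].
Proof.
by rewrite !mxE /= !(mulr0, mulr1, add0r, addr0, subr0, oppr0, mulrN).
Qed.

Fact levi_civita_bilinear : bilinear_for *:%R *:%R levi_civita.
Proof.
have linE a (x y : g) i : (a *: x + y) i 0 = a * x i 0 + y i 0.
  by rewrite mxE [X in X + _]mxE.
split=> w a u v; apply: colE; rewrite /= !linE.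
- have [-> -> -> ->] := levi_civitaE (a *: u + v) w.
  have [-> -> -> ->] := levi_civitaE u w.
  have [-> -> -> ->] := levi_civitaE v w.
  by rewrite !linE; split; ring.
- have [-> -> -> ->] := levi_civitaE w (a *: u + v).
  have [-> -> -> ->] := levi_civitaE w u.
  have [-> -> -> ->] := levi_civitaE w v.
  by rewrite !linE; split; ring.
Qed.
HB.instance Definition _ := bilinear_isBilinear.Build R g g g *:%R *:%R
  levi_civita levi_civita_bilinear.

Lemma levi_civita_koszul : koszul_formula h3R_bracket S03 levi_civita.
Proof.
move=> u v w; rewrite (S03E (levi_civita u v) w).
have [-> -> -> ->] := levi_civitaE u v.
by rewrite !S03_bracket; field.
Qed.

Lemma levi_civita_unique (nabla : g -> g -> g) :
  koszul_formula h3R_bracket S03 nabla ->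
  forall u v, nabla u v = levi_civita u v.
Proof.
move=> hn u v.
have h w : S03 (nabla u v) w = S03 (levi_civita u v) w.
  have n2 : (2 : R) != 0 by rewrite pnatr_eq0.
  by apply: (mulfI n2); rewrite hn levi_civita_koszul.
move: (nabla u v) (levi_civita u v) h => x y h.
by apply: colE; split;
  [move: (h e1) | move: (h e4) | move: (h e3) | move: (h e2)];
  rewrite !S03E !mxE /= !(mulr0, mulr1, add0r, addr0).
Qed.

End H3R.

(* Main.v *)
Require Import Defs.
From mathcomp Require Import all_boot all_order all_algebra.
From mathcomp Require Import sesquilinear reals.
From mathcomp Require Import ring.
Import Order.TTheory GRing.Theory Num.Theory.
Local Open Scope ring_scope.

(** In the basis (e1, e2, e3, e4) everything is rational: J swaps e2 and e4,
    while D maps e2 to e2/2 - e4/4 and e4 to 3/4 e4. Since R0(v, u)v, for v in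
    the span of e2 and e4, is a multiple of the sum of the coordinates of v, it
    vanishes at v4, and sqrt 2 cancels from the v3 term of Ric0. *)

Section Coordinates.
Variable R : realType.
Local Notation g := 'cV[R]_4.

(** A normal form preserved by the vector operations, the bracket and all maps below. [col4_eq] then
    splits a vector identity into four scalar ones, left to [field]. *)
Definition col4 (a b c d : R) : g :=
  a *: e1 R + b *: e2 R + c *: e3 R + d *: e4 R.

Lemma col4E (a b c d : R) :
  [/\ col4 a b c d 0 0 = a, col4 a b c d 1 0 = b,
      col4 a b c d 2 0 = c & col4 a b c d 3 0 = d].
Proof. by rewrite !mxE /= !(mulr0, mulr1, add0r, addr0). Qed.

Lemma col4_eta (u : g) : u = col4 (u 0 0) (u 1 0) (u 2 0) (u 3 0).
Proof.
apply: Defs.colE; by case: (col4E (u 0 0) (u 1 0) (u 2 0) (u 3 0)) => -> -> -> ->.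
Qed.

Lemma col4_eq (a b c d a' b' c' d' : R) :
  a = a' -> b = b' -> c = c' -> d = d' -> col4 a b c d = col4 a' b' c' d'.
Proof. by move=> -> -> -> ->. Qed.

Lemma col4D (a b c d a' b' c' d' : R) :
  col4 a b c d + col4 a' b' c' d' = col4 (a + a') (b + b') (c + c') (d + d').
Proof. by apply: Defs.colE; rewrite !mxE; split; ring. Qed.

Lemma col4N (a b c d : R) : - col4 a b c d = col4 (- a) (- b) (- c) (- d).
Proof. by apply: Defs.colE; rewrite !mxE; split; ring. Qed.

Lemma col4Z (k a b c d : R) :
  k *: col4 a b c d = col4 (k * a) (k * b) (k * c) (k * d).
Proof. by apply: Defs.colE; rewrite !mxE; split; ring. Qed.

Lemma col4_bracket (a b c d a' b' c' d' : R) :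
  h3R_bracket (col4 a b c d) (col4 a' b' c' d') = col4 0 0 (a * b' - b * a') 0.
Proof.
rewrite /h3R_bracket.
by case: (col4E a b c d) (col4E a' b' c' d') => -> -> _ _ [-> -> _ _];
  rewrite /col4 !scale0r !add0r addr0.
Qed.

Lemma col4_levi_civita (a b c d a' b' c' d' : R) :
  levi_civita (col4 a b c d) (col4 a' b' c' d') =
  col4 (2^-1 * (b * c' + c * b')) 0 (2^-1 * (a * b' - b * a'))
       (- (2^-1 * (a * c' + c * a'))).
Proof.
rewrite [LHS]col4_eta; case: (levi_civitaE (col4 a b c d) (col4 a' b' c' d')).
by case: (col4E a b c d) (col4E a' b' c' d') => -> -> -> _ [-> -> -> _] -> -> -> ->.
Qed.

Local Notation r := (Num.sqrt (2 : R)).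

Lemma sqr_sqrt2 : r ^+ 2 = 2.
Proof. by rewrite sqr_sqrtr // ler0n. Qed.

(** With [r] moved to the numerator, [field] needs only the relation [sqr_sqrt2]. *)
Lemma invsqrt2 : r^-1 = r / 2.
Proof.
have r0 : r != 0 by rewrite gt_eqF // sqrtr_gt0 ltr0n.
by apply: (mulfI r0); rewrite mulfV // mulrA -expr2 sqr_sqrt2 mulfV ?pnatr_eq0.
Qed.

Lemma v1E : v1 R = col4 1 0 0 0.
Proof. by rewrite /col4 !scale0r !addr0 scale1r. Qed.

Lemma v2E : v2 R = col4 0 0 1 0.
Proof. by rewrite /col4 !scale0r !add0r addr0 scale1r. Qed.

Lemma v3E : v3 R = col4 0 (r / 2) 0 (r / 2).
Proof. by rewrite /col4 !scale0r add0r addr0 -scalerDr -invsqrt2. Qed.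

Lemma v4E : v4 R = col4 0 (r / 2) 0 (- (r / 2)).
Proof. by rewrite /col4 !scale0r add0r addr0 scaleNr -scalerBr -invsqrt2. Qed.

(** Inverse change of basis: e2 = (v3 + v4) / sqrt 2 and e4 = (v3 - v4) / sqrt 2. *)
Lemma col4_v_basis (a b c d : R) :
  col4 a b c d = a *: v1 R + c *: v2 R + (r / 2 * (b + d)) *: v3 R
                 + (r / 2 * (b - d)) *: v4 R.
Proof.
rewrite v1E v2E v3E v4E !col4Z !col4D.
have E := sqr_sqrt2; by apply: col4_eq; field: E.
Qed.

Lemma map_of_mx_v (A : 'M[R]_4) (j : 'I_4) :
  map_of_mx (v_basis R) A (v_basis R)`_j =
  A 0 j *: v1 R + A 1 j *: v2 R + A 2 j *: v3 R + A 3 j *: v4 R.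
Proof.
rewrite map_of_mxE ?v_basis_free // !big_ord_recl big_ord0 addr0 /= !addrA.
by congr (_ + _ + _ + _); congr (A _ _ *: _); apply/val_inj.
Qed.

(** Linearity applied to [col4_v_basis], for any [A] so as to serve both [prodJ] and [solitonD]. The
    coordinate c goes with column 1 because v2 = e3. *)
Lemma col4_map_of_mx (A : 'M[R]_4) (a b c d : R) :
  let w j := A 0 j *: v1 R + A 1 j *: v2 R + A 2 j *: v3 R + A 3 j *: v4 R in
  map_of_mx (v_basis R) A (col4 a b c d) =
  a *: w 0 + c *: w 1 + (r / 2 * (b + d)) *: w 2 + (r / 2 * (b - d)) *: w 3.
Proof.
rewrite /= -!map_of_mx_v col4_v_basis 3!linearD.
by congr (_ + _ + _ + _); exact: linearZ.
Qed.

Lemma col4_prodJ (a b c d : R) : prodJ R (col4 a b c d) = col4 a d c b.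
Proof.
rewrite [LHS]col4_map_of_mx !mxE /= (col4_v_basis a d) !scale0r !scale1r.
(* Changing the sign of the v4 coefficient turns b - d into d - b and keeps b + d, which swaps b and
   d. *)
rewrite !(add0r, addr0) scaleN1r scalerN -scaleNr -mulrN opprB.
by rewrite [d + b]addrC.
Qed.

Lemma col4_solitonD (a b c d : R) :
  solitonD R (col4 a b c d) =
  col4 (a / 2) (b / 2) c (3 / 4 * d - b / 4).
Proof.
rewrite [LHS]col4_map_of_mx !mxE /= !scale0r !(add0r, addr0).
rewrite v1E v2E v3E v4E !col4Z !col4D col4Z col4D.
have E := sqr_sqrt2; by apply: col4_eq; field: E.
Qed.

(** As J is an involution, this connection is half of nabla_u v + J nabla_u (J v), the part of nabla
    preserving the eigenspaces of J. Since v4 spans one of them and has constant norm, it is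
    parallel: only b' + d' enters, and the e2 and e4 coordinates of the value agree. *)
Lemma col4_canonical_connection (a b c d a' b' c' d' : R) :
  canonical_connection (@levi_civita R) (prodJ R)
    (col4 a b c d) (col4 a' b' c' d') =
  col4 ((2 * b * c' + c * b' + c * d') / 4) (- (a * c' + c * a') / 4)
       ((a * b' + a * d' - 2 * b * a') / 4) (- (a * c' + c * a') / 4).
Proof.
rewrite /canonical_connection /nablaJ !(col4_prodJ, col4_levi_civita).
by rewrite !(col4Z, col4N, col4D); apply: col4_eq; field.
Qed.

Local Notation curvature0 :=
  (curvature (@h3R_bracket R) (canonical_connection (@levi_civita R) (prodJ R))).

Lemma curvature0_e1 (a b c d : R) :
  curvature0 (col4 1 0 0 0) (col4 a b c d) (col4 1 0 0 0) =
  col4 0 (- (3 / 8) * b) (c / 8) (- (3 / 8) * b).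
Proof.
rewrite /curvature !(col4_bracket, col4_canonical_connection) col4N !col4D.
by apply: col4_eq; field.
Qed.

Lemma curvature0_e3 (a b c d : R) :
  curvature0 (col4 0 0 1 0) (col4 a b c d) (col4 0 0 1 0) =
  col4 (a / 8) (b / 8) 0 (b / 8).
Proof.
rewrite /curvature !(col4_bracket, col4_canonical_connection) col4N !col4D.
by apply: col4_eq; field.
Qed.

(** Free p and q cover v3 (q = p) and v4 (q = - p) in one computation without square roots. *)
Lemma curvature0_e24 (p q a b c d : R) :
  curvature0 (col4 0 p 0 q) (col4 a b c d) (col4 0 p 0 q) =
  (p * (p + q) / 8) *: col4 (- 3 * a) 0 c 0.
Proof.
rewrite /curvature !(col4_bracket, col4_canonical_connection) col4N !col4D col4Z.
by apply: col4_eq; field.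
Qed.

Lemma ricci_v_basis (br nabla : g -> g -> g) (u : g) :
  ricci_operator br (@S03 R) nabla (v_basis R) u =
  curvature br nabla (v1 R) u (v1 R) + curvature br nabla (v2 R) u (v2 R)
  + curvature br nabla (v3 R) u (v3 R) - curvature br nabla (v4 R) u (v4 R).
Proof.
rewrite /ricci_operator; move: (curvature br nabla) => K.
under eq_bigr do rewrite v_basis_orthonormal eqxx mul1r.
by rewrite !big_ord_recl big_ord0 addr0 /= !scale1r scaleN1r !addrA.
Qed.

(** Pointwise agreement suffices, as the operator only evaluates the connection at vectors. *)
Lemma eq_ricci_operator (br nabla nabla' : g -> g -> g) (u : g) :
  nabla =2 nabla' ->
  ricci_operator br (@S03 R) nabla (v_basis R) u =
  ricci_operator br (@S03 R) nabla' (v_basis R) u.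
Proof. by move=> E; rewrite !ricci_v_basis /curvature !E. Qed.

(* [u] is left untyped so that [*:] gets the same instance as in the theorem;
   converting between the two instances takes minutes. *)
Lemma ricci_canonical u :
  ricci_operator (@h3R_bracket R) (@S03 R)
    (canonical_connection (@levi_civita R) (prodJ R)) (v_basis R) u =
  - (3 / 4) *: u + solitonD R u.
Proof.
rewrite ricci_v_basis v1E v2E v3E v4E (col4_eta u).
move: (u 0 0) (u 1 0) (u 2 0) (u 3 0) => a b c d.
have v3_coef : r / 2 * (r / 2 + r / 2) / 8 = 8^-1.
  by have E := sqr_sqrt2; field: E.
rewrite curvature0_e1 curvature0_e3 !curvature0_e24 v3_coef.
(* The v4 term disappears here, its factor p + q being zero. *)
rewrite subrr mulr0 mul0r scale0r subr0 col4_solitonD.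
rewrite !col4Z !col4D.
by apply: col4_eq; field.
Qed.

(** Modulo the central vectors e3 and e4, D is multiplication by 1/2, so the left side is (1/2 +
    1/2) [u, v]; and D fixes e3, which spans all brackets. *)
Lemma solitonD_derivation : is_derivation (@h3R_bracket R) (solitonD R).
Proof.
move=> u v; rewrite (col4_eta u) (col4_eta v).
rewrite !(col4_bracket, col4_solitonD, col4D).
by apply: col4_eq; field.
Qed.

End Coordinates.

Theorem theorem4p12 (R : realType)
    (nabla : {bilinear 'cV[R]_4 -> 'cV[R]_4 -> 'cV[R]_4}) :
  koszul_formula (@h3R_bracket R) (@S03 R) nabla ->
  let nabla0 := canonical_connection nabla (prodJ R) in
  let Ric0 := ricci_operator (@h3R_bracket R) (@S03 R) nabla0 (v_basis R) in
  first_kind_soliton (@h3R_bracket R) Ric0 /\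
  is_derivation (@h3R_bracket R) (solitonD R) /\
  (forall u, Ric0 u = - (3 / 4) *: u + solitonD R u).
Proof.
(* The Koszul formula determines nabla, so the closed form [levi_civita] can replace it. *)
move=> /levi_civita_unique nablaE nabla0 Ric0.
have nabla0E : nabla0 =2 canonical_connection (@levi_civita R) (prodJ R).
  by move=> u v; rewrite /nabla0 /canonical_connection /nablaJ !nablaE.
have RicE u : Ric0 u = - (3 / 4) *: u + solitonD R u.
  by rewrite /Ric0 (eq_ricci_operator R _ _ _ u nabla0E); exact: ricci_canonical.
split; last by split; [exact: solitonD_derivation | exact: RicE].
by exists (- (3 / 4)), (solitonD R); split; [exact: solitonD_derivation | exact: RicE].
Qed.
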